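(* Let $n\geq 3$. Let $H$ be either a non-transitive subgroup of $\operatorname{Sym}_n$ or an abelian subgroup of $\operatorname{Sym}_n$ such that $(1,2,\dots,n)\notin H$. Let $S=S_n(H)$ and let $r$ be a positive integer. (i) If $m_1,\dots,m_r\geq 3$ and $1\leq i_1,\dots,i_r\leq n$, then $\bigcup_{j=1}^r Sa_{i_j}^{m_j}S$ is a prime ideal of $S$. (ii) For every $m\geq 1$, $Sz^mS$ is a prime ideal of $S$. (iii) If $m_1,\dots,m_r\geq 3$, $1\leq i_1,\dots,i_r\leq n$ and $m\geq 1$, then $(Sz^mS)\cup\bigcup_{j=1}^r Sa_{i_j}^{m_j}S$ is a prime ideal of $S$.
   Context: $S_n(H)$ is the monoid with presentation $\langle a_1,\dots,a_n \mid a_1\cdots a_n = a_{\sigma(1)}\cdots a_{\sigma(n)},\ \sigma\in H\rangle$, and $z=a_1a_2\cdots a_n$. An ideal $Q$ of a monoid $S$ is prime if $Q\neq S$ and, for $u,v\in S$, $uSv\subseteq Q$ implies $u\in Q$ or $v\in Q$. *)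

(* Defs.v *)
From HB Require Import structures.
From mathcomp Require Import all_boot all_order all_fingroup.
Set Implicit Arguments. Unset Strict Implicit. Unset Printing Implicit Defensive.

(* Words over the alphabet {a_1,...,a_n}; letter a_{k+1} is encoded by k : 'I_n. *)
Definition word (n : nat) := seq 'I_n.

Definition zword (n : nat) : word n := enum 'I_n.

Definition zperm (n : nat) (s : {perm 'I_n}) : word n := map s (enum 'I_n).

(* The congruence on words generated by the defining relations of S_n(H):
   two words are congruent iff they represent the same element of S_n(H). *)
Inductive cong (n : nat) (H : {set {perm 'I_n}}) : word n -> word n -> Prop :=
| cong_refl u : cong H u u
| cong_sym u v : cong H u v -> cong H v u
| cong_trans u v w : cong H u v -> cong H v w -> cong H u w
| cong_rel (p q : word n) (s : {perm 'I_n}) :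
    s \in H -> cong H (p ++ zword n ++ q) (p ++ zperm s ++ q).

Definition in_ideal n (H : {set {perm 'I_n}}) (u w : word n) : Prop :=
  exists p q : word n, cong H w (p ++ u ++ q).

Definition zpow (n m : nat) : word n := flatten (nseq m (zword n)).

(* A subset Q of S = S_n(H), given as a predicate on representing words,
   is a prime ideal: it is well defined on S (saturated for the congruence),
   a two-sided ideal, proper, and uSv ⊆ Q implies u ∈ Q or v ∈ Q. *)
Definition prime_ideal n (H : {set {perm 'I_n}}) (Q : word n -> Prop) : Prop :=
  [/\ (forall u v, cong H u v -> Q u -> Q v),
      (forall u p q, Q u -> Q (p ++ u ++ q)),
      (exists w, ~ Q w)
    & (forall u v, (forall s, Q (u ++ s ++ v)) -> Q u \/ Q v)].

Definition ncycle (n : nat) : {perm 'I_n} := perm (@ordS_inj n).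

(* Main.v *)
Require Import Defs.
From HB Require Import structures.
From Stdlib Require Import Classical.
From mathcomp Require Import all_boot all_order all_fingroup zify.
Set Implicit Arguments. Unset Strict Implicit. Unset Printing Implicit Defensive.

(** A block is a factor [zperm s] with [s \in H]; rewriting exchanges blocks.
    Given words [u], [v] outside the ideal, it suffices to extend [u] on the
    right and [v] on the left, still outside the ideal, so that every word
    congruent to the extension of [u] ends with a square [i i] and every word
    congruent to that of [v] starts with a square [j j].  With [k] different
    from [i] and [j], no block and no forbidden factor crosses the middle of
    [u .. i i k k j j .. v], because it would have to contain a square.

    If [H] is not transitive, appending a letter [i] outside the orbit of the
    last letter of [z] never completes a block, and enough copies of [i] do.
    If [H] is abelian and transitive, hence regular, one appends [i k k]: since
    [H] omits the [n]-cycle, two blocks never overlap in [n - 1] letters, and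
    this remains true, by commutation, for blocks occurring at different stages
    of a rewriting; so appending a letter completes a block for at most one
    letter.  The left extension is the mirror image of the right one. *)

(** * Blocks and the congruence *)

Lemma size_zperm n (s : {perm 'I_n}) : size (zperm s) = n.
Proof. by rewrite size_map size_enum_ord. Qed.

Lemma zperm_uniq n (s : {perm 'I_n}) : uniq (zperm s).
Proof. by rewrite map_inj_uniq ?enum_uniq //; apply: perm_inj. Qed.

Lemma zperm1 n : zperm (1%g : {perm 'I_n}) = zword n.
Proof. by rewrite /zperm (eq_map (@perm1 _)) map_id. Qed.

Lemma nth_zperm n (s : {perm 'I_n}) x0 (k : 'I_n) : nth x0 (zperm s) k = s k.
Proof. by rewrite (nth_map x0) ?size_enum_ord // nth_ord_enum. Qed.

Lemma cong_block n (H : {set {perm 'I_n}}) (p q : word n) s t :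
  s \in H -> t \in H -> cong H (p ++ zperm s ++ q) (p ++ zperm t ++ q).
Proof.
move=> sH tH; apply: (@cong_trans _ _ _ (p ++ zword n ++ q)).
- exact/cong_sym/cong_rel.
- exact: cong_rel.
Qed.

(** Exchanges of blocks can be undone, so [step] works in both directions, which settles [cong_sym].
    All words on the way stay congruent to [u], so [step] may assume this. *)
Lemma cong_invariant n (H : {group {perm 'I_n}}) (P : word n -> Prop) u v :
  (forall (p q : word n) s t, s \in H -> t \in H ->
     cong H u (p ++ zperm s ++ q) ->
     P (p ++ zperm s ++ q) -> P (p ++ zperm t ++ q)) ->
  cong H u v -> P u -> P v.
Proof.
move=> step uv Pu.
suff: forall x y, cong H x y -> cong H u x -> (P x <-> P y).
  by move=> /(_ u v uv (cong_refl _ _)) [/(_ Pu)].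
move=> x y; elim=> {x y} [x _|x y xy IH uy|x y w xy IH1 yw IH2 ux|p q s sH ux] //.
- by apply: iff_sym; apply: IH; apply: cong_trans uy (cong_sym xy).
- by apply: (iff_trans (IH1 ux)); apply: IH2; apply: cong_trans ux xy.
- move: ux; rewrite -zperm1 => ux; split; first exact: step.
  by apply: step => //; apply: cong_trans ux _; apply: cong_block.
Qed.

Lemma cong_size n (H : {group {perm 'I_n}}) u v : cong H u v -> size u = size v.
Proof.
move=> uv; apply: (cong_invariant (P := fun w => size u = size w)) uv (erefl _).
by move=> p q s t _ _ _ ->; rewrite !size_cat !size_zperm.
Qed.

Lemma cong_cat n (H : {set {perm 'I_n}}) (x y u v : word n) :
  cong H u v -> cong H (x ++ u ++ y) (x ++ v ++ y).
Proof.
elim=> {u v} [u|u v _ IH|u v w _ IH1 _ IH2|p q s sH].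
- exact: cong_refl.
- exact: cong_sym.
- exact: cong_trans IH1 IH2.
- by have := cong_rel (x ++ p) (q ++ y) sH; rewrite !catA.
Qed.

(** * Occurrences of blocks and rewriting left of a bound *)

Definition occurs n (s : {perm 'I_n}) (p : nat) (w : word n) : Prop :=
  p + n <= size w /\ forall x0 (k : 'I_n), nth x0 w (p + k) = s k.

Definition block_at n (H : {set {perm 'I_n}}) (p : nat) (w : word n) : Prop :=
  exists2 s, s \in H & occurs s p w.

Lemma occurs_cat n (s : {perm 'I_n}) (p q : word n) :
  occurs s (size p) (p ++ zperm s ++ q).
Proof.
split=> [|x0 k]; first by rewrite !size_cat size_zperm leq_add2l leq_addr.
rewrite nth_cat ifN -?leqNgt ?leq_addr // addKn nth_cat size_zperm ltn_ord.
exact: nth_zperm.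
Qed.

Lemma occurs_rcons n (s : {perm 'I_n}) p w a :
  occurs s p w -> occurs s p (rcons w a).
Proof.
case=> le_pw occ; split=> [|x0 k]; first by rewrite size_rcons leqW.
by rewrite nth_rcons (leq_trans _ le_pw) ?ltn_add2l.
Qed.

(** The bound [r] is an induction parameter: letters from position [r + n - 1] on stay frozen. *)
Inductive reach n (H : {set {perm 'I_n}}) (r : nat) (u : word n) : word n -> Prop :=
| reach_refl : reach H r u u
| reach_step (p q : word n) s t :
    s \in H -> t \in H -> size p < r ->
    reach H r u (p ++ zperm s ++ q) -> reach H r u (p ++ zperm t ++ q).

Lemma reach_size n (H : {set {perm 'I_n}}) r u v :
  reach H r u v -> size v = size u.
Proof. by elim=> // p q s t _ _ _ _ <-; rewrite !size_cat !size_zperm. Qed.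

Lemma reach_nth n (H : {set {perm 'I_n}}) r u v :
  reach H r u v ->
  forall x0 j, r + n <= j.+1 -> nth x0 u j = nth x0 v j.
Proof.
elim=> // p q s t _ _ lt_pr _ IH x0 j le_j; rewrite IH // !nth_cat !size_zperm.
by have [-> ->] : (j < size p) = false /\ (j - size p < n) = false by lia.
Qed.

Lemma reach0 n (H : {set {perm 'I_n}}) u v : reach H 0 u v -> v = u.
Proof. by case. Qed.

Lemma reach_rcons n (H : {set {perm 'I_n}}) r u v a :
  reach H r u v -> reach H r (rcons u a) (rcons v a).
Proof.
elim=> [|p q s t sH tH lt_pr _]; first exact: reach_refl.
rewrite !rcons_cat; exact: reach_step.
Qed.

(** The rewriting is cut at its exchanges at position [r]: the witnesses are the word just before
    the first one and the word just after the last one. *)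
Lemma reach_split n (H : {set {perm 'I_n}}) r u v :
  reach H r.+1 u v ->
  reach H r u v \/
  (exists2 w, reach H r u w & block_at H r w) /\
  (exists2 w, block_at H r w & reach H r w v).
Proof.
elim=> [|p q s t sH tH lt_pr _ IH]; first by left; apply: reach_refl.
have [eq_pr|ne_pr] := eqVneq (size p) r.
  right; split; last first.
    by exists (p ++ zperm t ++ q); [exists t; rewrite -?eq_pr //; apply: occurs_cat|apply: reach_refl].
  case: IH => [ru|[? _] //].
  by exists (p ++ zperm s ++ q) => //; exists s; rewrite -?eq_pr //; apply: occurs_cat.
have {}lt_pr : size p < r by lia.
case: IH => [ru|[ru [w bw rw]]]; [left|right; split=> //; exists w => //].
  exact: reach_step ru.
exact: reach_step rw.
Qed.

Lemma cong_reach n (H : {group {perm 'I_n}}) u v :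
  cong H u v -> reach H (size u - n).+1 u v.
Proof.
move=> uv; apply: cong_invariant (uv) (reach_refl _ _ _).
move=> p q s t sH tH cu; apply: reach_step => //.
by rewrite (cong_size cu) !size_cat size_zperm; lia.
Qed.

(** * Shifts of overlapping blocks *)

(* [shift H e] says that two blocks of [H] can overlap at distance [e]. *)
Definition shift n (H : {set {perm 'I_n}}) (e : nat) : Prop :=
  exists2 r : {perm 'I_n}, r \in H & forall j k : 'I_n, j = k + e :> nat -> r j = k.

Lemma shiftD n (H : {group {perm 'I_n}}) d e :
  shift H d -> shift H e -> shift H (d + e).
Proof.
case=> r rH shr [s sH shs]; exists (r * s)%g; first exact: groupM.
move=> j k eq_jk; have lt_i : k + e < n by have := ltn_ord j; lia.
by rewrite permM (shr j (Ordinal lt_i)) ?(shs _ k) //=; lia.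
Qed.

(* Commutation with the shift by [f] propagates the relation [r (k + e) = k]
   from the last [f] indices to all of them. *)
Lemma shift_window n (H : {group {perm 'I_n}}) e f (r : {perm 'I_n}) :
  abelian H -> 0 < f -> (n <= f \/ shift H f) -> r \in H ->
  (forall j k : 'I_n, j = k + e :> nat -> n <= j + f -> r j = k) ->
  shift H e.
Proof.
move=> abH f_gt0 shf rH win; exists r => // j.
have [m] := ubnP (n - j); elim: m j => // m IH j lt_m k eq_jk.
have [le_n|lt_n] := leqP n (j + f); first exact: win.
case: shf => [|[s sH shs]]; first lia.
have lt_k : k + f < n by lia.
rewrite -(shs (Ordinal lt_n) j) // -permM -(centsP abH r rH s sH) permM.
by rewrite (IH (Ordinal lt_n) _ (Ordinal lt_k)) /=; [apply: shs| lia| lia].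
Qed.

(** Where the words agree, on the last [f] letters of the block [s], one has [s (k + e) = t k]; so
    [s * t^-1] is the partial shift that [shift_window] extends. *)
Lemma shift_overlap n (H : {group {perm 'I_n}}) e f s t p w w' :
  abelian H -> 0 < f -> (n <= f \/ shift H f) ->
  s \in H -> t \in H -> occurs s p w -> occurs t (p + e) w' ->
  (forall x0 j, p + n <= j + f -> nth x0 w j = nth x0 w' j) ->
  shift H e.
Proof.
move=> abH f_gt0 shf sH tH [_ occs] [_ occt] agree.
apply: (shift_window abH f_gt0 shf (groupM sH (groupVr tH))) => j k eq_jk le_n.
rewrite permM; apply: (canLR (permK t)).
rewrite -(occs j) -(occt j k) agree; last by lia.
by congr nth; lia.
Qed.

(* The blocks [p] and [q] need not coexist in one word.  The induction splits the
   rewriting at its first and last visits to the rightmost position it uses: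
   letters to the right of that block are frozen, and [shift_window] applies. *)
Lemma shift_reach n (H : {group {perm 'I_n}}) r p q w w' d :
  abelian H -> r <= p -> block_at H p w -> reach H r w w' -> block_at H q w' ->
  0 < d < n -> q = p + d \/ p = q + d -> shift H d.
Proof.
move=> abH; elim: r p q w w' d => [|r IH] p q w w' d le_rp bw rww' bw' d_bd pq.
  have agree : forall x0 j, nth x0 w j = nth x0 w' j by rewrite (reach0 rww').
  have n_gt0 : 0 < n by lia.
  have shf : n <= n \/ shift H n by left.
  case: bw bw' => [s sH os] [t tH ot].
  case: pq => pq; first by apply: (shift_overlap abH n_gt0 shf sH tH os (w' := w')); rewrite -?pq.
  by apply: (shift_overlap abH n_gt0 shf tH sH ot (w' := w)); rewrite -?pq.
have agree := reach_nth rww'.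
case: (reach_split rww') => [rw|[[w0 rw0 bw0] [w2 bw2 rw2]]].
  by apply: (IH p q w w') => //; lia.
have [s sH os] := bw; have [t tH ot] := bw'.
(* The block at [p] and the one met at the first visit to [r] give this shift by induction. If
   [n <= p - r], the whole block at [p] is frozen. *)
have shf : n <= p - r \/ shift H (p - r).
  have [?|lt_n] := leqP n (p - r); first by left.
  by right; apply: (IH p r w w0) => //; lia.
case: pq => pq.
  apply: (shift_overlap abH (f := p - r) _ shf sH tH os (w' := w')); rewrite -?pq //; first lia.
  by move=> x0 j le; apply: agree; lia.
(* Now [q < p]. For [q < r] the shifts by [p - r] and [r - q] add up to [d]; for [r < q] the overlap
   is read from [q], the last visit to [r] giving the window; for [q = r] the shift by [p - r] is
   the one by [d]. *)
have [lt_qr|lt_rq|eq_qr] := ltngtP q r.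
- have {}shf : shift H (p - r) by case: shf => //; lia.
  have shq : shift H (r - q) by apply: (IH r q w2 w') => //; lia.
  by have := shiftD shf shq; congr shift; lia.
- apply: (shift_overlap abH (f := q - r) _ _ tH sH ot (w' := w)); rewrite -?pq //; first lia.
    have [?|lt_n] := leqP n (q - r); first by left.
    by right; apply: (IH r q w2 w') => //; lia.
  by move=> x0 j le; rewrite agree //; lia.
- by case: shf; [lia|rewrite -eq_qr pq addKn].
Qed.

(** * Forbidden factors and appending one letter *)

(** A common class for the generators of the three kinds of ideals, stable under [mirror], so that
    one primeness argument serves them all. *)
Definition admissible n (F : word n -> Prop) : Prop :=
  forall f, F f ->
  (exists m a, 3 <= m /\ f = nseq m a) \/ (exists2 m, 1 <= m & f = zpow n m).

Definition avoids n (H : {set {perm 'I_n}}) (F : word n -> Prop) (u : word n) :=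
  forall f x y, F f -> ~ cong H u (x ++ f ++ y).

Lemma zpowSr n m : zpow n m.+1 = zpow n m ++ zword n.
Proof.
elim: m => [|m IH]; first by rewrite /zpow /= cats0.
by rewrite -[LHS]/(zword n ++ zpow n m.+1) {1}IH catA.
Qed.

Lemma end_block_nth n (s : {perm 'I_n}) v y (k : 'I_n) x0 :
  v = y ++ zperm s -> nth x0 v (size v + k - n) = s k.
Proof.
move=> ->; have [_ occ] := occurs_cat s y [::]; move: (occ x0 k).
by rewrite cats0 size_cat size_zperm; congr (nth _ _ _ = _); lia.
Qed.

Lemma end_block_last n (s : {perm 'I_n}) u a y (k : 'I_n) :
  rcons u a = y ++ zperm s -> k.+1 = n -> s k = a.
Proof.
move=> e eq_k; rewrite -(end_block_nth k a e) size_rcons nth_rcons.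
by rewrite ltnNge (_ : size u <= _) /= ?if_same //; lia.
Qed.

Lemma end_block_penult n (s : {perm 'I_n}) u b a y (k : 'I_n) :
  rcons (rcons u b) a = y ++ zperm s -> k.+2 = n -> s k = b.
Proof.
move=> e eq_k; rewrite -(end_block_nth k b e) !size_rcons !nth_rcons size_rcons.
have -> : (size u).+2 + k - n = size u by lia.
by rewrite ltnSn ltnn eqxx.
Qed.

Definition no_end_block n (H : {set {perm 'I_n}}) (u : word n) (a : 'I_n) : Prop :=
  forall u' y s, cong H u u' -> s \in H -> rcons u' a <> y ++ zperm s.

(** Only a block ending at the last letter could change it, and none ever appears there; all
    rewriting takes place in the prefix. *)
Lemma cong_rcons n (H : {group {perm 'I_n}}) u a w :
  no_end_block H u a -> cong H (rcons u a) w ->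
  exists2 u', cong H u u' & w = rcons u' a.
Proof.
move=> neb cw.
apply: (cong_invariant (P := fun w => exists2 u', cong H u u' & w = rcons u' a)) cw _.
  move=> p q s t sH tH _ [u' cu']; case: (lastP q) => [|{}q b].
    by rewrite cats0 => e; case: (neb u' p s cu' sH).
  rewrite -!rcons_cat => /rcons_inj[e ->]; exists (p ++ zperm t ++ q) => //.
  by apply: cong_trans cu' _; rewrite -e; apply: cong_block.
by exists u => //; apply: cong_refl.
Qed.

(** A new forbidden factor would be a suffix. A power of a letter needs a prefix ending in [a a],
    and a power of [z] ends in the block of the identity. *)
Lemma avoids_rcons n (H : {group {perm 'I_n}}) F u a :
  admissible F -> avoids H F u -> no_end_block H u a ->
  (forall u' y, cong H u u' -> u' <> rcons (rcons y a) a) ->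
  avoids H F (rcons u a).
Proof.
move=> admF avu neb neq f x y Ff /(cong_rcons neb)[u' cu'].
case: (lastP y) => [|{}y b]; last first.
  by rewrite -!rcons_cat => /rcons_inj[e _]; apply: (avu f x y Ff); rewrite e.
rewrite cats0; case: (admF f Ff) => [[[|[|[|m]]] [b [// _ ->]]]|[[//|m] _ ->]].
  have -> : nseq m.+3 b = nseq m b ++ [:: b; b; b] by rewrite -addn3 nseqD.
  rewrite catA -cat_rcons -cat_rcons cats1 => /esym/rcons_inj[e eb].
  by apply: (neq u' (x ++ nseq m b) cu'); rewrite e eb.
by rewrite zpowSr catA -zperm1 => e; apply: (neb u' _ _ cu' (group1 H) (esym e)).
Qed.

(** * Freezing the right end: the non-transitive case *)

(** Every block ends in some [s lst], so a final [i] never completes one. Copies of [i] are added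
    only until there are two, since three might form a forbidden power. *)
Lemma freeze_intransitive n (H : {group {perm 'I_n}}) F u (lst i : 'I_n) :
  lst.+1 = n -> (forall s, s \in H -> s lst != i) ->
  admissible F -> avoids H F u ->
  exists v, avoids H F (u ++ v) /\
    forall w, cong H (u ++ v) w -> exists y, w = rcons (rcons y i) i.
Proof.
move=> eq_lst nlast admF avu.
have neb v : no_end_block H v i.
  by move=> v' y s _ sH e; have := nlast s sH; rewrite (end_block_last e eq_lst) eqxx.
(* If [v'] ended in [i], then [cong_rcons] applied to the reversed congruence would make [v] end in
   [i]. *)
have nend v v' y : (forall y, v <> rcons y i) -> cong H v v' -> v' <> rcons y i.
  move=> nv cv ev; rewrite ev in cv.
  by have [y' _ e] := cong_rcons (neb y) (cong_sym cv); case: (nv y').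
have [[u1 eu]|nu] := classic (exists u1, u = rcons u1 i); last first.
  have {}nu y : u <> rcons y i by move=> e; apply: nu; exists y.
  have av1 : avoids H F (rcons u i).
    by apply: avoids_rcons => // u' y /(nend _ _ _ nu).
  exists [:: i; i]; rewrite -!cat_rcons cats0; split.
    apply: avoids_rcons => // w y /(cong_rcons (neb u))[u' cu' ->] /rcons_inj[e].
    exact: nend nu cu' e.
  by move=> w /(cong_rcons (neb _))[w' /(cong_rcons (neb _))[w'' _ ->] ->]; exists w''.
have [[u2 eu1]|nu1] := classic (exists u2, u1 = rcons u2 i).
  exists [::]; rewrite cats0; split=> // w; rewrite eu eu1.
  by move=> /(cong_rcons (neb _))[w' /(cong_rcons (neb _))[w'' _ ->] ->]; exists w''.
have {}nu1 y : u1 <> rcons y i by move=> e; apply: nu1; exists y.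
exists [:: i]; rewrite cats1; split.
  apply: avoids_rcons => // w y; rewrite eu.
  move=> /(cong_rcons (neb _))[u' cu' ->] /rcons_inj[e].
  exact: nend nu1 cu' e.
move=> w; rewrite eu.
by move=> /(cong_rcons (neb _))[w' /(cong_rcons (neb _))[w'' _ ->] ->]; exists w''.
Qed.

(** * Freezing the right end: the regular abelian case *)

Lemma exists_neq2 n (a b : 'I_n) : 3 <= n -> exists i : 'I_n, i != a /\ i != b.
Proof.
move=> n_ge3; have /card_gt0P[i] : 0 < #|~: [set a; b]|.
  by rewrite cardsCs setCK card_ord cards2; case: (a != b); lia.
by rewrite !inE negb_or => /andP[? ?]; exists i.
Qed.

(** Commutation gives [s (r x) = r (s x)], so the value at [x] determines [s] on the orbit of [x],
    which is everything. *)
Lemma abelian_semiregular n (H : {group {perm 'I_n}}) x s t :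
  abelian H -> (forall a b, exists2 r : {perm 'I_n}, r \in H & r a = b) ->
  s \in H -> t \in H -> s x = t x -> s = t.
Proof.
move=> abH tr sH tH e; apply/permP => y; have [r rH <-] := tr x y.
by rewrite -!permM (centsP abH r rH s sH) (centsP abH r rH t tH) !permM e.
Qed.

Lemma cong_tail n (H : {group {perm 'I_n}}) u u' :
  cong H u u' ->
  (forall x0, nth x0 u' (size u).-1 = nth x0 u (size u).-1) \/
  (n <= size u /\
   exists2 w, block_at H (size u - n) w /\ size w = size u
            & reach H (size u - n) w u').
Proof.
move=> cu; case: (reach_split (cong_reach cu)) => [ru|[_ [w bw rw]]].
  left=> x0; case: (posnP (size u - n)) => [e|pos].
    by rewrite e in ru; rewrite (reach0 ru).
  by rewrite (reach_nth ru) //; lia.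
right; have sw : size w = size u by rewrite -(reach_size rw) -(cong_size cu).
split; last by exists w.
by case: bw => s _ [+ _]; rewrite sw; lia.
Qed.

Lemma freeze_abelian n (H : {group {perm 'I_n}}) F u :
  3 <= n -> abelian H -> ~ shift H 1 ->
  (forall a b, exists2 r : {perm 'I_n}, r \in H & r a = b) ->
  admissible F -> avoids H F u ->
  exists v i, avoids H F (u ++ v) /\
    forall w, cong H (u ++ v) w -> exists y, w = rcons (rcons y i) i.
Proof.
move=> n_ge3 abH nsh tr admF avu.
have lt_pen : n.-2 < n by lia.
have lt_lst : n.-1 < n by lia.
pose pen := Ordinal lt_pen; pose lst := Ordinal lt_lst.
have pE : pen.+2 = n by rewrite /=; lia.
have lE : lst.+1 = n by rewrite /=; lia.
(* The default [pen] is reached only for empty [u], where one more letter completes no block and no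
   square can end the word. *)
pose l := nth pen u (size u).-1.
have [sl slH slE] := tr pen l.
(* Only [sl] has penultimate letter [l]; avoiding its last letter leaves that block incomplete, and
   avoiding [l] prevents a square. *)
have [i [i_l i_sl]] := exists_neq2 l (sl lst) n_ge3.
have neb1 : no_end_block H u i.
  move=> u' y s cu sH e.
  have sy : (size u).+1 = size y + n.
    by rewrite (cong_size cu) -(size_rcons u' i) e size_cat size_zperm.
  case: (cong_tail cu) => [lastE|[le_n [w [bw sw] rw]]].
    have: s pen = sl pen.
      rewrite slE -(end_block_nth pen pen e) /l -lastE size_rcons -(cong_size cu).
      rewrite nth_rcons -(cong_size cu).
      have -> : (size u).+1 + pen - n = (size u).-1 by lia.
      by rewrite prednK ?leqnn //; lia.
    move/(abelian_semiregular abH tr sH slH) => es.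
    by move: i_sl; rewrite -es (end_block_last e lE) eqxx.
  apply: nsh; apply: (@shift_reach _ _ (size u - n) (size u - n) (size y)) => //.
  - by case: bw => t tH ot; exists t => //; apply: occurs_rcons ot.
  - exact: reach_rcons rw.
  - by exists s => //; rewrite e -[X in y ++ X]cats0; apply: occurs_cat.
  - by lia.
  - by left; lia.
(* If the last letter was rewritten, take [w] after the last use of the final position. A later
   exchange one position to the left would give a shift by 1, so [u'] keeps the last two letters of
   a block, which differ. *)
have nii u' y : cong H u u' -> u' <> rcons (rcons y i) i.
  move=> cu e; have su : size u = (size y).+2 by rewrite (cong_size cu) e !size_rcons.
  case: (cong_tail cu) => [lastE|[le_n [w [bw sw] rw]]].
    by move: i_l; rewrite /l -lastE su e nth_rcons size_rcons ltnn eqxx eqxx.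
  have agree x0 j : size y <= j -> nth x0 w j = nth x0 u' j.
    case ep: (size u - n) rw bw => [|p] rw bw; first by rewrite (reach0 rw).
    move=> le_j; case: (reach_split rw) => [rw'|[[w0 rw0 bw0] _]].
      by apply: (reach_nth rw'); lia.
    case: nsh; apply: (@shift_reach _ _ p p.+1 p w w0) => //; first by lia.
    by right; lia.
  case: bw => t tH [_ ot].
  have /perm_inj : t pen = t lst.
    rewrite -!(ot i) !agree //=; try lia.
    rewrite e !nth_rcons size_rcons.
    have -> : size u - n + n.-2 = size y by lia.
    have -> : size u - n + n.-1 = (size y).+1 by lia.
    by rewrite !ltnn !eqxx ltnS leqnn.
  by move/(congr1 val) => /=; lia.
have av1 := avoids_rcons admF avu neb1 nii.
(* Words congruent to [u] may end in [i], so a second [i] could create a cube; a new letter [k] is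
   used. A block ending in [i k] could only be that of [si], whose last letter [k] avoids. *)
have [si siH siE] := tr pen i.
have [k [k_i k_si]] := exists_neq2 i (si lst) n_ge3.
have neb2 : no_end_block H (rcons u i) k.
  move=> w y s /(cong_rcons neb1)[u' cu ->] sH e.
  have /(abelian_semiregular abH tr sH siH) es : s pen = si pen.
    by rewrite siE (end_block_penult e pE).
  by move: k_si; rewrite -es (end_block_last e lE) eqxx.
have av2 : avoids H F (rcons (rcons u i) k).
  apply: avoids_rcons => // w y /(cong_rcons neb1)[u' cu ->] /rcons_inj[_ e].
  by rewrite e eqxx in k_i.
have neb3 : no_end_block H (rcons (rcons u i) k) k.
  move=> w y s /(cong_rcons neb2)[u' cu ->] sH e.
  have /perm_inj : s pen = s lst by rewrite (end_block_penult e pE) (end_block_last e lE).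
  by move/(congr1 val) => /=; lia.
exists [:: i; k; k], k; rewrite -!cat_rcons cats0; split.
  apply: avoids_rcons => // w y /(cong_rcons neb2)[w' /(cong_rcons neb1)[u' cu ->] ->].
  by move/rcons_inj=> [/rcons_inj[_ e]]; rewrite e eqxx in k_i.
by move=> w /(cong_rcons neb3)[w' /(cong_rcons neb2)[w'' _ ->] ->]; exists w''.
Qed.

(** * Mirror symmetry and freezing the left end *)

(** Reversal alone would not preserve [z]; relabelling by [rev_ord] restores it, at the cost of
    replacing [H] by a conjugate. *)
Definition mirror n (w : word n) : word n := rev (map (@rev_ord n) w).

Lemma mirrorK n : involutive (@mirror n).
Proof. by move=> w; rewrite /mirror map_rev revK mapK //; apply: rev_ordK. Qed.

Lemma mirror_cat n (u v : word n) : mirror (u ++ v) = mirror v ++ mirror u.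
Proof. by rewrite /mirror map_cat rev_cat. Qed.

Definition rev_perm n : {perm 'I_n} := perm (@rev_ord_inj n).

Lemma rev_permE n (k : 'I_n) : rev_perm n k = rev_ord k.
Proof. exact: permE. Qed.

Lemma rev_enum_ord n : rev (enum 'I_n) = map (@rev_ord n) (enum 'I_n).
Proof.
apply: (inj_map val_inj); apply: (eq_from_nth (x0 := 0)) => [|t].
  by rewrite map_rev size_rev !size_map.
rewrite map_rev size_rev size_map size_enum_ord => lt_t.
have lt_t' : n - t.+1 < n by lia.
rewrite nth_rev size_map size_enum_ord // val_enum_ord nth_iota //.
rewrite -map_comp (nth_map (Ordinal lt_t)) ?size_enum_ord //.
by rewrite -[t]/(val (Ordinal lt_t)) nth_ord_enum.
Qed.

Lemma mirror_zperm n (s : {perm 'I_n}) :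
  mirror (zperm s) = zperm (s ^ rev_perm n)%g.
Proof.
rewrite /mirror /zperm -2!map_rev rev_enum_ord -!map_comp; apply: eq_map => k; rewrite /comp.
by rewrite -{2}[k]rev_ordK -[in RHS]rev_permE permJ rev_permE.
Qed.

Lemma mirror_zpow n m : mirror (zpow n m) = zpow n m.
Proof.
elim: m => // m IH; rewrite zpowSr mirror_cat IH -zperm1 mirror_zperm conj1g.
by rewrite zperm1 -zpowSr.
Qed.

Lemma conj_rev_permK n (H : {set {perm 'I_n}}) :
  ((H :^ rev_perm n) :^ rev_perm n)%g = H.
Proof.
rewrite -conjsgM (_ : (rev_perm n * rev_perm n = 1)%g) ?conjsg1 //.
by apply/permP => k; rewrite permM !rev_permE rev_ordK perm1.
Qed.

Lemma cong_mirror n (H : {set {perm 'I_n}}) u v :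
  cong H u v -> cong (H :^ rev_perm n)%g (mirror u) (mirror v).
Proof.
elim=> {u v} [u|u v _ IH|u v w _ IH1 _ IH2|p q s sH].
- exact: cong_refl.
- exact: cong_sym.
- exact: cong_trans IH1 IH2.
- rewrite !mirror_cat -!catA -{1}zperm1 !mirror_zperm conj1g zperm1.
  by apply: cong_rel; rewrite memJ_conjg.
Qed.

Lemma cong_mirrorV n (H : {set {perm 'I_n}}) u v :
  cong (H :^ rev_perm n)%g (mirror u) v -> cong H u (mirror v).
Proof. by move/cong_mirror; rewrite conj_rev_permK mirrorK. Qed.

Lemma avoids_mirror n (H : {set {perm 'I_n}}) F u :
  avoids H F u -> avoids (H :^ rev_perm n)%g (F \o @mirror n) (mirror u).
Proof.
move=> avu f x y Ff /cong_mirrorV; rewrite !mirror_cat -catA.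
exact: avu Ff.
Qed.

Lemma admissible_mirror n (F : word n -> Prop) :
  admissible F -> admissible (F \o @mirror n).
Proof.
move=> admF f /admF[[m [a [m_ge3 e]]]|[m m_gt0 e]]; [left|right].
  exists m, (rev_ord a); split=> //.
  by rewrite -[f]mirrorK e /mirror map_nseq rev_nseq.
by exists m => //; rewrite -[f]mirrorK e mirror_zpow.
Qed.

Definition trans_on n (H : {set {perm 'I_n}}) : Prop :=
  forall a b, exists2 r : {perm 'I_n}, r \in H & r a = b.

Lemma freeze_right n (H : {group {perm 'I_n}}) F u :
  3 <= n -> ~ trans_on H \/ (abelian H /\ ~ shift H 1) ->
  admissible F -> avoids H F u ->
  exists v i, avoids H F (u ++ v) /\
    forall w, cong H (u ++ v) w -> exists y, w = rcons (rcons y i) i.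
Proof.
move=> n_ge3 hH admF avu.
have [trH|ntr] := classic (trans_on H).
  by case: hH => [//|[abH nsh]]; apply: freeze_abelian.
have lt_lst : n.-1 < n by lia.
pose lst := Ordinal lt_lst.
have [i nlst] : exists i, forall s, s \in H -> s lst != i.
  (* Otherwise [lst] could be sent to every letter, and going from [a] to [b] through [lst] would
     make [H] transitive. *)
  apply: NNPP => all; apply: ntr => a b.
  have reach_lst c : exists2 s : {perm 'I_n}, s \in H & s lst = c.
    apply: NNPP => nc; apply: all; exists c => s sH.
    by apply/eqP => e; apply: nc; exists s.
  have [s sH <-] := reach_lst a; have [t tH <-] := reach_lst b.
  by exists (s^-1 * t)%g; [rewrite groupM ?groupV|rewrite permM permK].
have lE : lst.+1 = n by rewrite /=; lia.
have [v frv] := freeze_intransitive lE nlst admF avu.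
by exists v, i.
Qed.

Lemma trans_on_conj n (H : {set {perm 'I_n}}) :
  trans_on (H :^ rev_perm n)%g -> trans_on H.
Proof.
move=> tr a b; have [_ /imsetP[s sH ->]] := tr (rev_perm n a) (rev_perm n b).
by rewrite permJ => /perm_inj e; exists s.
Qed.

(** Reversing the positions reverses the direction of the shift, hence the inverse of [s]. *)
Lemma shift_conj n (H : {group {perm 'I_n}}) e :
  shift (H :^ rev_perm n)%g e -> shift H e.
Proof.
case=> _ /imsetP[s sH ->] sh; exists (s^-1)%g; first by rewrite groupV.
move=> j k e_jk; apply: (canLR (permK s)); apply: (@perm_inj _ (rev_perm n)).
rewrite -permJ; apply/esym/sh; rewrite !rev_permE /=.
by have := ltn_ord j; lia.
Qed.

Lemma freeze_left n (H : {group {perm 'I_n}}) F u :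
  3 <= n -> ~ trans_on H \/ (abelian H /\ ~ shift H 1) ->
  admissible F -> avoids H F u ->
  exists v i, avoids H F (v ++ u) /\
    forall w, cong H (v ++ u) w -> exists y, w = i :: i :: y.
Proof.
move=> n_ge3 hH admF avu.
have hH' : ~ trans_on (H :^ rev_perm n)%G \/
    (abelian (H :^ rev_perm n)%G /\ ~ shift (H :^ rev_perm n)%G 1).
  case: hH => [ntr|[abH nsh]]; [left|right]; first by move/trans_on_conj.
  by split; [rewrite /= abelianJ|move/shift_conj].
have [v [i [avv fr]]] :=
  freeze_right n_ge3 hH' (admissible_mirror admF) (avoids_mirror avu).
exists (mirror v), (rev_ord i); split.
  move=> f x y Ff /cong_mirror; rewrite !mirror_cat mirrorK -catA.
  by apply: avv; rewrite /= mirrorK.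
move=> w /cong_mirror; rewrite mirror_cat mirrorK => /fr[y e].
by exists (mirror y); rewrite -[w]mirrorK e /mirror !map_rcons !rev_rcons.
Qed.

(** * Factors near the middle square *)

Lemma eq_cat_prefix (T : Type) (u v s t : seq T) :
  u ++ v = s ++ t -> size u <= size s -> exists r, s = u ++ r /\ v = r ++ t.
Proof.
elim: u s => [|a u IH] s /=; first by move=> -> _; exists s.
by case: s => // b s [-> /IH{}IH] /IH[r [-> ->]]; exists r.
Qed.

(* A factor of length at least 3 meeting both sides of [k; k] would contain
   one of the squares [i; i], [k; k], [j; j], but not be a power of a letter. *)
Lemma factor_across (T : eqType) (i j k : T) x0 y0 x y p b q :
  x = rcons (rcons x0 i) i -> y = j :: j :: y0 ->
  3 <= size b -> k != i -> k != j ->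
  (forall d t, t.+1 < size b -> nth d b t != nth d b t.+1) \/
  (exists a, b = nseq (size b) a) ->
  x ++ [:: k; k] ++ y = p ++ b ++ q ->
  (exists q', q = q' ++ [:: k; k] ++ y /\ x = p ++ b ++ q') \/
  (exists p', p = x ++ [:: k; k] ++ p' /\ y = p' ++ b ++ q).
Proof.
move=> ex ey sb ki kj hb e; set w := x ++ _ in e.
have [le1|gt1] := leqP (size p + size b) (size x).
  left; rewrite catA in e; have [|r [-> ->]] := eq_cat_prefix (esym e).
    by rewrite size_cat.
  by exists r; rewrite -catA.
have [le2|gt2] := leqP (size x + 2) (size p).
  right; rewrite /w catA in e; have [|r [-> ->]] := eq_cat_prefix e.
    by rewrite size_cat.
  by exists r; rewrite -catA.
have nb d t : t < size b -> nth d b t = nth d w (size p + t).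
  by move=> lt_t; rewrite e nth_cat ifN -?leqNgt ?leq_addr // addKn nth_cat lt_t.
have sx : size x = (size x0).+2 by rewrite ex !size_rcons.
have wi d t : size x <= t.+2 -> t < size x -> nth d w t = i.
  move=> le_t lt_t; rewrite /w nth_cat lt_t ex !nth_rcons size_rcons.
  have [<-|ne] := eqVneq t (size x0); first by rewrite ltnSn ltnn.
  have -> : t = (size x0).+1 by lia.
  by rewrite ltnn eqxx.
have wk d t : size x <= t -> t < size x + 2 -> nth d w t = k.
  move=> le_t lt_t; rewrite /w nth_cat ltnNge le_t /=.
  by have [->|->] : t - size x = 0 \/ t - size x = 1 by lia.
have wj d t : size x + 2 <= t -> t < size x + 4 -> nth d w t = j.
  move=> le_t lt_t; rewrite /w nth_cat ltnNge (leq_trans (leq_addr 2 _) le_t) ey /=.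
  by have [->|->] : t - size x = 2 \/ t - size x = 3 by lia.
exfalso; case: hb => [sq|[a ea]].
  have clash t c : size p <= t -> t.+1 < size p + size b ->
      nth k w t = c -> nth k w t.+1 = c -> False.
    move=> le_t lt_t e1 e2; have lt_t' : (t - size p).+1 < size b by lia.
    have := sq k _ lt_t'; rewrite !nb ?(ltnW lt_t') // addnS subnKC //.
    by rewrite e1 e2 eqxx.
  (* According to where it starts, the factor contains [i i], [k k] or [j j]. *)
  have [lt|ge] := ltnP (size p).+1 (size x).
    by apply: (@clash (size x).-2 i); try lia; apply: wi; lia.
  have [lt|ge'] := ltnP (size p) (size x).+1.
    by apply: (@clash (size x) k); try lia; apply: wk; lia.
  by apply: (@clash (size x + 2) j); try lia; apply: wj; lia.
have const t : size p <= t -> t < size p + size b -> nth k w t = a.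
  move=> le_t lt_t; rewrite -(subnKC le_t) -nb; last lia.
  by rewrite ea nth_nseq ifT //; lia.
have eqa t c : size p <= t < size p + size b -> nth k w t = c -> c = a.
  by case/andP=> le_t lt_t <-; apply: const.
have [lt|ge] := ltnP (size p) (size x).
  have ka : k = a by apply: (eqa (size x)); [lia|apply: wk; lia].
  have ia : i = a by apply: (eqa (size x).-1); [lia|apply: wi; lia].
  by move: ki; rewrite {1}ka {1}ia eqxx.
have ka : k = a by apply: (eqa (size x).+1); [lia|apply: wk; lia].
have ja : j = a by apply: (eqa (size x + 2)); [lia|apply: wj; lia].
by move: kj; rewrite {1}ka {1}ja eqxx.
Qed.

Lemma zperm_nosquare n (s : {perm 'I_n}) d t :
  t.+1 < size (zperm s) -> nth d (zperm s) t != nth d (zperm s) t.+1.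
Proof.
move=> lt_t; rewrite nth_uniq ?zperm_uniq ?(ltnW lt_t) //.
by rewrite neq_ltn leqnn.
Qed.

Lemma size_zpow n m : size (zpow n m) = m * n.
Proof. by elim: m => // m IH; rewrite zpowSr size_cat IH size_enum_ord mulSn addnC. Qed.

Lemma nth_zpow n m d t : t < m * n -> nth d (zpow n m) t = nth d (zword n) (t %% n).
Proof.
elim: m t => // m IH t; rewrite mulSn -[zpow n m.+1]/(zword n ++ zpow n m) => lt_t.
rewrite nth_cat size_enum_ord; case: ltnP => [lt|ge]; first by rewrite modn_small.
by rewrite IH; [rewrite -{2}(subnK ge) modnDr|lia].
Qed.

Lemma zpow_nosquare n m d t :
  1 < n -> t.+1 < size (zpow n m) -> nth d (zpow n m) t != nth d (zpow n m) t.+1.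
Proof.
rewrite size_zpow => n_gt1 lt_t; rewrite !nth_zpow ?(ltnW lt_t) //.
rewrite nth_uniq ?enum_uniq ?size_enum_ord ?ltn_pmod //; try lia.
rewrite modnS; case: ifP => [dv|_]; last by rewrite neq_ltn leqnn.
apply/eqP => e; have dt : n %| t by rewrite /dvdn e.
by move: dv; rewrite -addn1 dvdn_addr // dvdn1; lia.
Qed.

Lemma admissible_shape n (F : word n -> Prop) f :
  3 <= n -> admissible F -> F f -> 3 <= size f /\
  ((forall d t, t.+1 < size f -> nth d f t != nth d f t.+1) \/
   (exists a, f = nseq (size f) a)).
Proof.
move=> n_ge3 admF /admF[[m [a [m_ge3 ->]]]|[m m_gt0 ->]].
  by rewrite size_nseq; split=> //; right; exists a.
split; first by rewrite size_zpow -[3]mul1n leq_mul.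
by left=> d t; apply: zpow_nosquare; apply: ltnW.
Qed.

(** * Primeness *)

Lemma prime_admissible n (H : {group {perm 'I_n}}) F :
  3 <= n -> ~ trans_on H \/ (abelian H /\ ~ shift H 1) -> admissible F ->
  prime_ideal H (fun w => exists2 f, F f & in_ideal H f w).
Proof.
move=> n_ge3 hH admF; split.
- move=> u v uv [f Ff [p [q e]]]; exists f => //; exists p, q.
  exact: cong_trans (cong_sym uv) e.
- move=> u p q [f Ff [p' [q' e]]]; exists f => //; exists (p ++ p'), (q' ++ q).
  by have := cong_cat p q e; rewrite !catA.
(* The empty word is outside: the congruence preserves length and generators have length at least
   3. *)
- exists [::] => -[f Ff [p [q /cong_size]]].
  by have [sf _] := admissible_shape n_ge3 admF Ff; rewrite !size_cat /=; lia.
move=> u v huv; apply: NNPP => /not_or_and[nu nv].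
have av w : ~ (exists2 f, F f & in_ideal H f w) -> avoids H F w.
  by move=> nw f x y Ff e; apply: nw; exists f => //; exists x, y.
have [s1 [i [av1 fr1]]] := freeze_right n_ge3 hH admF (av u nu).
have [s2 [j [av2 fr2]]] := freeze_left n_ge3 hH admF (av v nv).
have [k [ki kj]] := exists_neq2 i j n_ge3.
have [f Ff [p [q]]] := huv (s1 ++ [:: k; k] ++ s2).
have -> : u ++ (s1 ++ [:: k; k] ++ s2) ++ v = (u ++ s1) ++ [:: k; k] ++ (s2 ++ v).
  by rewrite -!catA.
have [sf shf] := admissible_shape n_ge3 admF Ff.
(* Invariant: the middle [k k] survives, and each side is rewritten within its own congruence
   class. *)
move=> /(cong_invariant (P := fun w => exists x y,
  [/\ cong H (u ++ s1) x, cong H (s2 ++ v) y & w = x ++ [:: k; k] ++ y])).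
case.
- move=> {}p {}q s t sH tH _ [x [y [cx cy e]]].
  have [x0 ex] := fr1 x cx; have [y0 ey] := fr2 y cy.
  have sz : 3 <= size (zperm s) by rewrite size_zperm.
  have [[q' [eq' ex']]|[p' [ep ey']]] :=
    factor_across ex ey sz ki kj (or_introl (@zperm_nosquare _ s)) (esym e).
    exists (p ++ zperm t ++ q'), y; split=> //; last by rewrite eq' -!catA.
    by apply: cong_trans cx _; rewrite ex'; apply: cong_block.
  exists x, (p' ++ zperm t ++ q); split=> //; last by rewrite ep -!catA.
  by apply: cong_trans cy _; rewrite ey'; apply: cong_block.
- by exists (u ++ s1), (s2 ++ v); split=> //; apply: cong_refl.
move=> x [y [cx cy e]].
have [x0 ex] := fr1 x cx; have [y0 ey] := fr2 y cy.
have [[q' [_ ex']]|[p' [_ ey']]] := factor_across ex ey sf ki kj shf (esym e).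
  by apply: (av1 f p q' Ff); rewrite -ex'.
by apply: (av2 f p' q Ff); rewrite -ey'.
Qed.

(** * The long cycle and the three kinds of ideals *)

Lemma shift1_ncycle n (H : {group {perm 'I_n}}) : 1 < n -> shift H 1 -> ncycle n \in H.
Proof.
move=> n_gt1 [r rH sh]; rewrite -[ncycle n]invgK groupV.
suff -> : ((ncycle n)^-1 = r)%g by [].
apply/permP => j; apply: (@perm_inj _ (ncycle n)); rewrite permKV.
have succ (a b : 'I_n) : a = b + 1 :> nat -> ncycle n b = a.
  move=> e; rewrite permE; apply: val_inj; rewrite /= -addn1 -e.
  by rewrite modn_small.
have [j0|j_gt0] := posnP j; last first.
  have lt_k : j.-1 < n by have := ltn_ord j; lia.
  by rewrite (sh j (Ordinal lt_k)) /= ?(succ j) //=; lia.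
(* It remains to find [r 0]: every [k] with [k + 1 < n] is already the image of [k + 1], so
   injectivity leaves only [n - 1]. *)
have [k ek] : exists k : 'I_n, r j = k by exists (r j).
have [lt|ge] := ltnP k.+1 n.
  have : r (Ordinal lt) = r j by rewrite ek; apply: sh; rewrite /= addn1.
  by move/perm_inj/(congr1 val); rewrite /= j0.
rewrite ek permE; apply: val_inj; rewrite /= j0.
have -> : k.+1 = n by have := ltn_ord k; lia.
by rewrite modnn.
Qed.

Lemma prime_ideal_ext n (H : {set {perm 'I_n}}) (Q Q' : word n -> Prop) :
  (forall w, Q w <-> Q' w) -> prime_ideal H Q -> prime_ideal H Q'.
Proof.
move=> eqQ [sat idl [w nw] pr]; split.
- by move=> u v uv /eqQ/(sat u v uv)/eqQ.
- by move=> u p q /eqQ/(idl u p q)/eqQ.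
- by exists w => /eqQ.
- move=> u v huv; have [s||] := pr u v; first exact/eqQ/huv.
  + by move/eqQ; left.
  + by move/eqQ; right.
Qed.

Theorem theorem4p6 (n : nat) (H : {group {perm 'I_n}}) :
  3 <= n ->
  (~~ [transitive H, on [set: 'I_n] | 'P] \/ (abelian H /\ ncycle n \notin H)) ->
  [/\ (forall (r : nat) (i : 'I_r -> 'I_n) (mm : 'I_r -> nat),
         0 < r -> (forall j, 3 <= mm j) ->
         prime_ideal H (fun w => exists j, in_ideal H (nseq (mm j) (i j)) w)),
      (forall m : nat, 1 <= m -> prime_ideal H (in_ideal H (zpow n m)))
    & (forall (r : nat) (i : 'I_r -> 'I_n) (mm : 'I_r -> nat) (m : nat),
         0 < r -> (forall j, 3 <= mm j) -> 1 <= m ->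
         prime_ideal H (fun w => in_ideal H (zpow n m) w \/
                                 exists j, in_ideal H (nseq (mm j) (i j)) w))].
Proof.
move=> n_ge3 hyp.
have hH : ~ trans_on H \/ (abelian H /\ ~ shift H 1).
  case: hyp => [ntr|[abH nc]]; [left=> trH|right; split=> // sh]; last first.
    by rewrite (shift1_ncycle (ltnW n_ge3) sh) in nc.
  case/negP: ntr; apply/imsetP; have n_gt0 := ltnW (ltnW n_ge3).
  exists (Ordinal n_gt0); rewrite ?inE //; apply/setP => b; rewrite inE.
  by have [s sH sb] := trH (Ordinal n_gt0) b; apply/esym/orbitP; exists s.
have prime F := @prime_admissible n H F n_ge3 hH.
split=> [r i mm _ mm_ge3|m m_gt0|r i mm m _ mm_ge3 m_gt0].
- apply: prime_ideal_ext (prime (fun f => exists j, f = nseq (mm j) (i j)) _).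
    by move=> w; split=> [[_ [j ->] ?]|[j ?]]; [exists j|eexists; first by exists j].
  by move=> _ [j ->]; left; exists (mm j), (i j).
- apply: prime_ideal_ext (prime (eq (zpow n m)) _).
    by move=> w; split=> [[_ <-]|]; [|exists (zpow n m)].
  by move=> _ <-; right; exists m.
- apply: prime_ideal_ext
    (prime (fun f => zpow n m = f \/ exists j, f = nseq (mm j) (i j)) _).
    move=> w; split=> [[_ [<-|[j ->]] ?]|[?|[j ?]]].
    + by left.
    + by right; exists j.
    + by exists (zpow n m) => //; left.
    + by eexists; first by right; exists j.
  by move=> _ [<-|[j ->]]; [right; exists m|left; exists (mm j), (i j)].
Qed.
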